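(* For every integer $n\ge1$, $\vartheta_0\vartheta_1\cdots\vartheta_n\Omega_{n+1}\le\omega_{n+2}$; that is, the order type of the initial segment $\{\gamma\in T:\gamma<\vartheta_0\vartheta_1\cdots\vartheta_n\Omega_{n+1}\}$ of the well-order $(T,<)$ is at most $\omega_{n+2}$.
   Context: $\omega_0:=1$ and $\omega_{k+1}:=\omega^{\omega_k}$ (so $\omega_1=\omega$). The set of formal terms $T$ and the function $S$ are defined simultaneously: $T$ is the least set such that $0\in T$, with $S(0):=-1$, and whenever $\alpha\in T$, $i\in\mathbb{N}$ and $S(\alpha)\le i+1$, then $\vartheta_i\alpha\in T$ with $S(\vartheta_i\alpha):=i$. Put $\Omega_i:=\vartheta_i0\in T$. Coefficients: $k_i(0):=0$; $k_i(\vartheta_j\beta):=\vartheta_j\beta$ if $j\le i$, and $k_i(\vartheta_j\beta):=k_i(\beta)$ if $j>i$. The ordering $<$ on $T$ (with $\le$ meaning $<$ or $=$) is defined recursively by: (1) $0<\alpha$ if $\alpha\neq0$; (2) if $i<j$, then $\vartheta_i\alpha<\vartheta_j\beta$; (3) if $\alpha<\beta$ and $k_i\alpha<\vartheta_i\beta$, then $\vartheta_i\alpha<\vartheta_i\beta$; (4) if $\alpha>\beta$ and $\vartheta_i\alpha\le k_i\beta$, then $\vartheta_i\alpha<\vartheta_i\beta$. This is a well-order on $T$. A term of $T$, when regarded as an ordinal, denotes the order type of the set of its predecessors in $(T,<)$. The set of predecessors of $\vartheta_0\vartheta_1\cdots\vartheta_n\Omega_{n+1}$ is the set $T_{n+1}[0]$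 of terms $\alpha\in T$ with $S(\alpha)\le0$ in which only symbols $\vartheta_j$ with $j<n+1$ occur. *)

(* Defs.v *)
From Stdlib Require Import ZArith Arith Lia List Wellfounded.
From Stdlib Require Import Classical ClassicalEpsilon.
From Stdlib Require Import FunctionalExtensionality ProofIrrelevance.

Record is_well_order {A : Type} (R : A -> A -> Prop) : Prop := {
  wo_wf : well_founded R;
  wo_trans : forall x y z, R x y -> R y z -> R x z;
  wo_total : forall x y, R x y \/ x = y \/ R y x
}.

(** Ordinals are handled as well-ordered types, i.e. as representatives of
    their order type; [ord_le] only depends on the isomorphism classes. *)
Record ord : Type := Ord {
  car :> Type;
  olt : car -> car -> Prop;
  olt_wo : is_well_order olt
}.

Arguments olt {o} _ _.
Arguments Ord {car olt} _.

(** [A] is order-isomorphic to an initial segment (possibly all) of [B]: the last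
    conjunct says that the range of [f] is downward closed. *)
Definition ord_le (A B : ord) : Prop :=
  exists f : A -> B,
    (forall x y, f x = f y -> x = y) /\
    (forall x y, olt x y <-> olt (f x) (f y)) /\
    (forall x b, olt b (f x) -> exists y, f y = b).

Lemma wo_irrefl (A : ord) (x : A) : ~ olt x x.
Proof.
  intro H. induction (wo_wf _ (olt_wo A) x) as [x _ IH]. exact (IH x H H).
Qed.

Definition unit_lt (_ _ : unit) : Prop := False.

Lemma unit_lt_wo : is_well_order unit_lt.
Proof.
  split.
  - intro x; constructor; intros y [].
  - intros x y z [].
  - intros [] []; auto.
Qed.

Definition ord_one : ord := Ord unit_lt_wo.

Definition finsupp {A : Type} (f : A -> nat) : Prop :=
  exists l : list A, forall a, f a <> 0 -> In a l.

Definition omega_exp_car (A : ord) : Type := {f : A -> nat | finsupp f}.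

(** The ordinal power [omega ^ A]: finitely supported functions, compared at the
    largest argument where they differ. *)
Definition omega_exp_lt (A : ord) (f g : omega_exp_car A) : Prop :=
  exists a : A, proj1_sig f a < proj1_sig g a /\
    forall b : A, olt a b -> proj1_sig f b = proj1_sig g b.

Lemma list_max (A : ord) (P : A -> Prop) (l : list A) :
  (forall a, P a -> In a l) -> (exists a, P a) ->
  exists a, P a /\ forall b, olt a b -> ~ P b.
Proof.
  revert P. induction l as [|c l IH]; intros P HP [a Ha].
  - destruct (HP a Ha).
  - destruct (classic (exists d, P d /\ d <> c)) as [Hd|Hd].
    + destruct (IH (fun d => P d /\ d <> c)) as [m [[Hm Hmc] Hmax]]; auto.
      { intros d [Hd1 Hd2]. destruct (HP d Hd1); [congruence|auto]. }
      destruct (classic (P c /\ olt m c)) as [[Hc Hmc']|Hc].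
      * exists c. split; auto. intros b Hb Pb.
        apply (Hmax b).
        -- exact (wo_trans _ (olt_wo A) _ _ _ Hmc' Hb).
        -- split; auto. intros ->. exact (wo_irrefl A c Hb).
      * exists m. split; auto. intros b Hb Pb.
        destruct (classic (b = c)) as [->|Hbc]; [tauto|].
        exact (Hmax b Hb (conj Pb Hbc)).
    + assert (a = c) by (apply NNPP; intro; apply Hd; eauto). subst a.
      exists c. split; auto. intros b Hb Pb. apply Hd. exists b. split; auto.
      intros ->. exact (wo_irrefl A c Hb).
Qed.

Lemma omega_exp_ext (A : ord) (f g : omega_exp_car A) :
  (forall a, proj1_sig f a = proj1_sig g a) -> f = g.
Proof.
  destruct f as [f Hf], g as [g Hg]; simpl. intro H.
  assert (f = g) by (apply functional_extensionality; exact H). subst g.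
  f_equal. apply proof_irrelevance.
Qed.

Definition supp_lt (A : ord) (a : A) (f : omega_exp_car A) : Prop :=
  forall b, proj1_sig f b <> 0 -> olt b a.

Definition supp_le (A : ord) (a : A) (f : omega_exp_car A) : Prop :=
  forall b, olt a b -> proj1_sig f b = 0.

Lemma omega_exp_acc_zero (A : ord) (f : omega_exp_car A) :
  (forall a, proj1_sig f a = 0) -> Acc (omega_exp_lt A) f.
Proof.
  intro H. constructor. intros g [a [Ha _]]. rewrite H in Ha. lia.
Qed.

Lemma omega_exp_max (A : ord) (f : omega_exp_car A) :
  (forall a, proj1_sig f a = 0) \/
  exists a, proj1_sig f a <> 0 /\ supp_le A a f.
Proof.
  destruct (classic (exists a, proj1_sig f a <> 0)) as [He|He].
  - right. destruct (proj2_sig f) as [l Hl].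
    destruct (list_max A _ l Hl He) as [a [Ha Hm]].
    exists a. split; auto. intros b Hb. apply NNPP. exact (Hm b Hb).
  - left. intro a. apply NNPP. intro H. apply He. eauto.
Qed.

Definition cut_fun (A : ord) (a : A) (f : A -> nat) (b : A) : nat :=
  if excluded_middle_informative (olt b a) then f b else 0.

Lemma cut_fun_finsupp (A : ord) (a : A) (f : A -> nat) :
  finsupp f -> finsupp (cut_fun A a f).
Proof.
  intros [l Hl]. exists l. intros b Hb. apply Hl. unfold cut_fun in Hb.
  destruct (excluded_middle_informative (olt b a)); tauto.
Qed.

Definition cut (A : ord) (a : A) (f : omega_exp_car A) : omega_exp_car A :=
  exist _ (cut_fun A a (proj1_sig f)) (cut_fun_finsupp A a _ (proj2_sig f)).

Lemma cut_supp_lt (A : ord) (a : A) (f : omega_exp_car A) :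
  supp_lt A a (cut A a f).
Proof.
  intros b Hb. simpl in Hb. unfold cut_fun in Hb.
  destruct (excluded_middle_informative (olt b a)); tauto.
Qed.

Lemma omega_exp_acc (A : ord) (a : A) :
  forall f, supp_le A a f -> Acc (omega_exp_lt A) f.
Proof.
  induction (wo_wf _ (olt_wo A) a) as [a _ IH].
  assert (H0 : forall f, supp_lt A a f -> Acc (omega_exp_lt A) f).
  { intros f Hf. destruct (omega_exp_max A f) as [Hz|[b [Hb Hs]]].
    - apply omega_exp_acc_zero; auto.
    - exact (IH b (Hf b Hb) f Hs). }
  assert (Hm : forall m f, proj1_sig f a = m -> supp_le A a f ->
                 Acc (omega_exp_lt A) f).
  { intro m. induction m as [m IHm] using (well_founded_induction lt_wf).
    assert (Hc : forall f0, Acc (omega_exp_lt A) f0 -> forall f,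
      cut A a f = f0 -> proj1_sig f a = m -> supp_le A a f ->
      Acc (omega_exp_lt A) f).
    { intros f0 Hacc. induction Hacc as [f0 _ IHf0].
      intros f Hcut Hfm Hs. constructor. intros g [c [Hgc Hgt]].
      assert (Hca : olt c a \/ c = a).
      { destruct (wo_total _ (olt_wo A) c a) as [H|[H|H]]; auto.
        rewrite (Hs c H) in Hgc. lia. }
      assert (Hsg : supp_le A a g).
      { intros b Hb. rewrite Hgt; [exact (Hs b Hb)|].
        destruct Hca as [H|H]; [|subst c; exact Hb].
        exact (wo_trans _ (olt_wo A) _ _ _ H Hb). }
      destruct Hca as [Hca|Hca].
      - apply (IHf0 (cut A a g)); auto.
        + subst f0. exists c. simpl. unfold cut_fun. split.
          * destruct (excluded_middle_informative (olt c a)); tauto.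
          * intros b Hb. rewrite (Hgt b Hb). reflexivity.
        + rewrite (Hgt a Hca). exact Hfm.
      - subst c. apply (IHm (proj1_sig g a)); auto. lia. }
    intros f. apply (Hc (cut A a f)); auto.
    apply H0, cut_supp_lt. }
  intros f. exact (Hm _ f eq_refl).
Qed.

Lemma omega_exp_lt_wo (A : ord) : is_well_order (omega_exp_lt A).
Proof.
  split.
  - intro f. destruct (omega_exp_max A f) as [Hz|[a [_ Hs]]].
    + apply omega_exp_acc_zero; auto.
    + exact (omega_exp_acc A a f Hs).
  - intros f g h [a [Ha Hag]] [b [Hb Hbh]].
    destruct (wo_total _ (olt_wo A) a b) as [H|[H|H]].
    + exists b. split; [rewrite (Hag b H); exact Hb|].
      intros c Hc. rewrite <- (Hbh c Hc). apply Hag.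
      exact (wo_trans _ (olt_wo A) _ _ _ H Hc).
    + subst b. exists a. split; [lia|].
      intros c Hc. rewrite (Hag c Hc). auto.
    + exists a. split; [rewrite <- (Hbh a H); exact Ha|].
      intros c Hc. rewrite (Hag c Hc). apply Hbh.
      exact (wo_trans _ (olt_wo A) _ _ _ H Hc).
  - intros f g.
    destruct (classic (exists a, proj1_sig f a <> proj1_sig g a)) as [Hd|Hd].
    + destruct (proj2_sig f) as [lf Hlf], (proj2_sig g) as [lg Hlg].
      destruct (list_max A (fun a => proj1_sig f a <> proj1_sig g a) (lf ++ lg))
        as [a [Ha Hmax]]; auto.
      { intros a Ha. apply in_or_app.
        destruct (Nat.eq_dec (proj1_sig f a) 0); [right; apply Hlg; lia|auto]. }
      assert (He : forall b, olt a b -> proj1_sig f b = proj1_sig g b).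
      { intros b Hb. apply NNPP. exact (Hmax b Hb). }
      destruct (Nat.lt_gt_cases (proj1_sig f a) (proj1_sig g a)) as [Hlt _].
      destruct (Hlt Ha) as [H|H].
      * left. exists a. auto.
      * right; right. exists a. split; auto. intros b Hb. symmetry; auto.
    + right; left. apply omega_exp_ext. intro a. apply NNPP. intro H.
      apply Hd. eauto.
Qed.

Definition omega_exp (A : ord) : ord := Ord (omega_exp_lt_wo A).

Fixpoint omega_tower (k : nat) : ord :=
  match k with
  | 0 => ord_one
  | S k => omega_exp (omega_tower k)
  end.

(** Raw terms [0] and [theta_i a]; the side condition on [S] is imposed
    by [inT] below. *)
Inductive term : Type :=
| Zero : term
| Theta : nat -> term -> term.

(** The function usually written [S], integer-valued because [S 0 = -1]. *)
Definition level (a : term) : Z :=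
  match a with
  | Zero => -1
  | Theta i _ => Z.of_nat i
  end.

Inductive inT : term -> Prop :=
| inT_zero : inT Zero
| inT_theta : forall i a,
    inT a -> (level a <= Z.of_nat i + 1)%Z -> inT (Theta i a).

Definition T : Type := {a : term | inT a}.

Fixpoint coef (i : nat) (a : term) : term :=
  match a with
  | Zero => Zero
  | Theta j b => if j <=? i then Theta j b else coef i b
  end.

(** Each clause only refers to comparisons of terms of smaller total length,
    so the least relation closed under the clauses is the recursively defined
    one.  Coefficients of terms in [T] are in [T], so defining the order on raw
    terms and restricting it to [T] loses nothing. *)
Inductive term_lt : term -> term -> Prop :=
| lt_zero : forall a, a <> Zero -> term_lt Zero a
| lt_level : forall i j a b, i < j -> term_lt (Theta i a) (Theta j b)
| lt_arg : forall i a b,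
    term_lt a b -> term_lt (coef i a) (Theta i b) ->
    term_lt (Theta i a) (Theta i b)
| lt_coef : forall i a b,
    term_lt b a ->
    term_lt (Theta i a) (coef i b) \/ Theta i a = coef i b ->
    term_lt (Theta i a) (Theta i b).

Definition T_lt (a b : T) : Prop := term_lt (proj1_sig a) (proj1_sig b).

Definition predecessors (t : T) : Type := {g : T | T_lt g t}.

Definition predecessors_lt (t : T) (g h : predecessors t) : Prop :=
  T_lt (proj1_sig g) (proj1_sig h).

Definition order_type (t : T) (W : is_well_order (predecessors_lt t)) : ord := Ord W.

Definition Omega (i : nat) : term := Theta i Zero.

(** [theta_0 (theta_1 (... (theta_n Omega_(n+1))))] *)
Definition theta_tower_term (n : nat) : term :=
  fold_right Theta (Omega (n + 1)) (seq 0 (n + 1)).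

Lemma theta_tower_inT (n : nat) : inT (theta_tower_term n).
Proof.
  assert (H : forall m k, inT (fold_right Theta (Omega (k + m)) (seq k m)) /\
    level (fold_right Theta (Omega (k + m)) (seq k m)) = Z.of_nat k).
  { induction m as [|m IH]; intro k; simpl.
    - rewrite Nat.add_0_r. split; auto.
      constructor; [constructor|simpl; lia].
    - split; auto. destruct (IH (S k)) as [H1 H2].
      replace (k + S m) with (S k + m) by lia.
      constructor; auto. rewrite H2. lia. }
  exact (proj1 (H (n + 1) 0)).
Qed.

Definition theta_tower (n : nat) : T :=
  exist _ (theta_tower_term n) (theta_tower_inT n).

(* Main.v *)
From Stdlib Require Import ZArith Arith Lia List Wellfounded.
From Stdlib Require Import Classical ClassicalEpsilon.
From Stdlib Require Import FunctionalExtensionality ProofIrrelevance.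
Require Import Defs.

(** Read a term [t] as a formal sum [U_m t_m + ... + U_1 t_1 + t_0], where every
    unit [U_(j+1)] dominates [U_j] and the coefficients [t_j] are ordinals below
    [epsilon_0].  The term [theta_i a] gets the coefficients
    - [0] at [j > i],
    - [omega^(a_(i+1)) + a_j] at [1 <= j <= i],
    - [omega^(omega^(a_(i+1))) * (a_0 + 1)] at [j = 0]
    ([coord]).  Tuples are compared at the largest index where they differ, and
    [t |-> (t_j)_j] turns out to be strictly increasing on [T]
    ([coord_lex_lt]), for the following reasons.

    Both operations on coefficients are strictly increasing in the coefficient,
    so [a < b] yields [theta_i a < theta_i b] when [a_(i+1) = b_(i+1)].  When
    [a_(i+1) < b_(i+1)], the tuple of [theta_i b] is closed under every such
    operation with parameter below [b_(i+1)]: a coefficient below the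
    corresponding one of [theta_i b] stays below it, and at indices [j >= 1] a
    coefficient equal to that of [theta_i b] stays equal to it.  Now
    [theta_i a] arises from [coef i a] by applying [theta_l] with [l >= i], and
    all the parameters involved lie below [b_(i+1)]; hence [coef i a <
    theta_i b] forces [theta_i a < theta_i b] ([Theta_lex_lt]).  Finally, the
    operations never decrease a coefficient, and the one at index [0] strictly
    increases it, so that [coef i b < theta_i b] ([coef_lex_lt_Theta]).

    Terms [g] of level at most [0] have only the coefficient [g_0], so they are
    mapped increasingly to ordinals.  If only [theta_0, ..., theta_n] occur in
    [g], then by induction [g_j] is below the tower of height [n + 1 - j] for
    [j >= 1], and therefore [g_0], into which double exponentials of such
    coefficients enter, is below the tower of height [n + 2] ([coord_depth]).
    A term of level at most [0] that contains [theta_(n+1)] is not below the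
    tower term ([stage_le_coef]), so the bound applies to all its predecessors.  A
    strictly increasing map between well-orders makes the first one isomorphic
    to an initial segment of the second ([ord_le_of_increasing]). *)

(** * Strictly increasing maps between well-orders *)

Section Collapse.

Variables (A B : ord) (f : A -> B).
Hypothesis f_mono : forall x y, olt x y -> olt (f x) (f y).

Definition least (P : B -> Prop) (b : B) : Prop :=
  P b /\ forall c, olt c b -> ~ P c.

Lemma least_exists (P : B -> Prop) (b : B) :
  P b -> exists m, least P m /\ ~ olt b m.
Proof.
  induction (wo_wf _ (olt_wo B) b) as [b _ IH]. intro Pb.
  destruct (classic (exists c, olt c b /\ P c)) as [[c [Hc Pc]]|Hn].
  - destruct (IH c Hc Pc) as [m [Hm Hcm]]. exists m. split; auto.
    intro Hbm. apply Hcm. exact (wo_trans _ (olt_wo B) _ _ _ Hc Hbm).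
  - exists b. split; [|apply wo_irrefl]. split; auto.
    intros c Hc Pc. apply Hn. eauto.
Qed.

(** The choice is only meaningful where the least element exists; this is
    established together with the recursion, in [collapse_spec]. *)
Definition collapse_step (x : A) (rec : forall y, olt y x -> B) : B :=
  epsilon (inhabits (f x)) (least (fun b => forall y H, rec y H <> b)).

Definition collapse : A -> B :=
  Fix (wo_wf _ (olt_wo A)) (fun _ => B) collapse_step.

Lemma collapse_eq (x : A) :
  collapse x = collapse_step x (fun y _ => collapse y).
Proof.
  unfold collapse. rewrite Fix_eq; auto.
  intros z g h H. replace h with g; auto.
  apply functional_extensionality_dep; intro y.
  apply functional_extensionality_dep; intro Hy. apply H.
Qed.

(** The value [f x] is always a candidate for [collapse x]: earlier values are
    at most [f y], which is less than [f x].  Hence the minimum exists, and it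
    is at most [f x]. *)
Lemma collapse_spec (x : A) :
  least (fun b => forall y, olt y x -> collapse y <> b) (collapse x) /\
  ~ olt (f x) (collapse x).
Proof.
  induction (wo_wf _ (olt_wo A) x) as [x _ IH].
  assert (Hf : forall y, olt y x -> collapse y <> f x).
  { intros y Hy He. apply (proj2 (IH y Hy)). rewrite He. auto. }
  destruct (least_exists (fun b => forall y, olt y x -> collapse y <> b) _ Hf)
    as [m [Hm Hle]].
  assert (Hs : least (fun b => forall y, olt y x -> collapse y <> b)
                 (collapse x)).
  { rewrite collapse_eq. unfold collapse_step. apply epsilon_spec. eauto. }
  split; auto. intro Hlt. exact (proj2 Hs _ Hlt Hf).
Qed.

Lemma ord_le_of_increasing : ord_le A B.
Proof.
  assert (Hm : forall x y, olt x y -> olt (collapse x) (collapse y)).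
  { intros x y Hxy.
    destruct (collapse_spec x) as [[_ Hx] _].
    destruct (collapse_spec y) as [[Hy _] _].
    destruct (wo_total _ (olt_wo B) (collapse x) (collapse y)) as [H|[H|H]];
      auto.
    - destruct (Hy x Hxy H).
    - destruct (Hx _ H). intros z Hz. apply Hy.
      exact (wo_trans _ (olt_wo A) _ _ _ Hz Hxy). }
  exists collapse. split; [|split].
  - intros x y He.
    destruct (wo_total _ (olt_wo A) x y) as [H|[H|H]]; auto;
      apply Hm in H; rewrite He in H; destruct (wo_irrefl _ _ H).
  - intros x y. split; auto. intro Hlt.
    destruct (wo_total _ (olt_wo A) x y) as [H|[H|H]]; auto.
    + subst y. destruct (wo_irrefl _ _ Hlt).
    + apply Hm in H.
      destruct (wo_irrefl _ _ (wo_trans _ (olt_wo B) _ _ _ H Hlt)).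
  - intros x b Hb. apply NNPP. intro Hn.
    destruct (collapse_spec x) as [[_ Hx] _]. apply (Hx b Hb).
    intros y _ He. apply Hn. eauto.
Qed.

End Collapse.

(** * Cantor normal forms *)

(** [Cons e r] stands for [omega^e + r]. *)
Inductive cnf : Type :=
| Nil : cnf
| Cons : cnf -> cnf -> cnf.

Inductive cnf_lt : cnf -> cnf -> Prop :=
| cnf_lt_nil : forall e r, cnf_lt Nil (Cons e r)
| cnf_lt_exp : forall d e r s, cnf_lt d e -> cnf_lt (Cons d r) (Cons e s)
| cnf_lt_rest : forall e r s, cnf_lt r s -> cnf_lt (Cons e r) (Cons e s).

Definition cnf_le (x y : cnf) : Prop := cnf_lt x y \/ x = y.

#[local] Hint Constructors cnf_lt : core.
#[local] Hint Unfold cnf_le : core.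

Lemma cnf_lt_irrefl (x : cnf) : ~ cnf_lt x x.
Proof. induction x; intro H; inversion H; auto. Qed.

Lemma cnf_lt_trans (x y z : cnf) : cnf_lt x y -> cnf_lt y z -> cnf_lt x z.
Proof.
  intro H. revert z.
  induction H; intros z Hz; inversion Hz; subst; auto.
Qed.

Lemma cnf_le_lt_trans (x y z : cnf) : cnf_le x y -> cnf_lt y z -> cnf_lt x z.
Proof. intros [H|<-] Hz; eauto using cnf_lt_trans. Qed.

Lemma cnf_le_trans (x y z : cnf) : cnf_le x y -> cnf_le y z -> cnf_le x z.
Proof. intros H [Hz|<-]; eauto using cnf_le_lt_trans. Qed.

Lemma cnf_lt_dec (x y : cnf) : {cnf_lt x y} + {cnf_le y x}.
Proof.
  assert (H : {cnf_lt x y} + {x = y} + {cnf_lt y x}).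
  { revert y. induction x as [|d IHd r IHr]; intros [|e s]; auto.
    destruct (IHd e) as [[H|<-]|H]; auto.
    destruct (IHr s) as [[H|<-]|H]; auto. }
  destruct H as [[H|<-]|H]; auto.
Qed.

Lemma cnf_lt_Cons_self (a r : cnf) : cnf_lt a (Cons a r).
Proof. revert r. induction a; auto. Qed.

Lemma cnf_lt_Cons_of_le (a e r : cnf) : cnf_le a e -> cnf_lt a (Cons e r).
Proof.
  intros [H| ->]; [|apply cnf_lt_Cons_self].
  apply cnf_lt_trans with (Cons a r); auto using cnf_lt_Cons_self.
Qed.

Definition head_le (x e : cnf) : Prop :=
  match x with Nil => True | Cons d _ => cnf_le d e end.

Inductive normal : cnf -> Prop :=
| normal_Nil : normal Nil
| normal_Cons : forall e r,
    normal e -> normal r -> head_le r e -> normal (Cons e r).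

#[local] Hint Constructors normal : core.

Lemma normal_rest_lt (e r : cnf) : normal (Cons e r) -> cnf_lt r (Cons e r).
Proof.
  revert e. induction r as [|d _ r IH]; intros e Hn; auto.
  inversion Hn as [|? ? ? Hr Hh]; subst. destruct Hh as [Hh| ->]; auto.
Qed.

(** [omega^a + x]: the new summand is absorbed when the leading exponent of [x]
    is larger. *)
Definition add_pow (a x : cnf) : cnf :=
  match x with
  | Nil => Cons a Nil
  | Cons e _ => if cnf_lt_dec a e then x else Cons a x
  end.

Lemma cnf_lt_not_le (x y : cnf) : cnf_lt x y -> ~ cnf_le y x.
Proof. intros H K. exact (cnf_lt_irrefl _ (cnf_le_lt_trans _ _ _ K H)). Qed.

Lemma add_pow_pos (a x : cnf) : cnf_lt Nil (add_pow a x).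
Proof. destruct x as [|e r]; simpl; auto. destruct (cnf_lt_dec a e); auto. Qed.

Lemma add_pow_lt (a x y : cnf) :
  cnf_lt x y -> cnf_lt (add_pow a x) (add_pow a y).
Proof.
  intro H. inversion H as [e s|d e r s Hde|e r s Hrs]; subst; simpl;
    repeat destruct cnf_lt_dec; auto.
  destruct (cnf_lt_not_le a e); eauto using cnf_lt_trans.
Qed.

Lemma add_pow_le (a x y : cnf) :
  cnf_le x y -> cnf_le (add_pow a x) (add_pow a y).
Proof. intros [H| ->]; auto using add_pow_lt. Qed.

Lemma le_add_pow (a x : cnf) : normal x -> cnf_le x (add_pow a x).
Proof.
  intro Hn. destruct x as [|e r]; simpl; auto.
  destruct (cnf_lt_dec a e) as [H|[H| ->]]; auto.
  left. constructor 3. apply normal_rest_lt. auto.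
Qed.

Lemma lt_add_pow_exponent (a x : cnf) : cnf_lt a (add_pow a x).
Proof.
  destruct x as [|e r]; simpl; [apply cnf_lt_Cons_self|].
  destruct (cnf_lt_dec a e); auto using cnf_lt_Cons_of_le.
Qed.

Lemma add_pow_absorb (a b p : cnf) :
  cnf_lt a b -> add_pow a (add_pow b p) = add_pow b p.
Proof.
  intro H. destruct p as [|e s]; simpl.
  - destruct cnf_lt_dec as [_|K]; auto. destruct (cnf_lt_not_le a b H K).
  - destruct (cnf_lt_dec b e) as [Hbe|_]; simpl;
      destruct cnf_lt_dec as [_|K]; auto.
    + destruct (cnf_lt_not_le a e); eauto using cnf_lt_trans.
    + destruct (cnf_lt_not_le a b H K).
Qed.

(** [omega^b + p] absorbs [omega^a] on its left, so both sides of the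
    hypothesis may be shifted by [omega^a]. *)
Lemma add_pow_lt_add_pow (a b x p : cnf) :
  cnf_lt a b -> cnf_lt x (add_pow b p) -> cnf_lt (add_pow a x) (add_pow b p).
Proof.
  intros Hab Hx. rewrite <- (add_pow_absorb a b p Hab).
  apply add_pow_lt. exact Hx.
Qed.

Lemma normal_add_pow (a x : cnf) :
  normal a -> normal x -> normal (add_pow a x).
Proof.
  intros Ha Hx. destruct x as [|e r]; simpl.
  - constructor; simpl; auto.
  - destruct (cnf_lt_dec a e); auto.
Qed.

(** [omega^(omega^a) * (x + 1)]: left multiplication by [omega^(omega^a)] adds
    [omega^a] on the left of every exponent, including the exponent [0] of the
    final summand [1]. *)
Fixpoint mul_succ (a x : cnf) : cnf :=
  match x with
  | Nil => Cons (add_pow a Nil) Nil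
  | Cons e r => Cons (add_pow a e) (mul_succ a r)
  end.

Lemma mul_succ_pos (a x : cnf) : cnf_lt Nil (mul_succ a x).
Proof. destruct x; simpl; auto. Qed.

Lemma add_pow_Nil_le (a x : cnf) : cnf_le (add_pow a Nil) (add_pow a x).
Proof. apply add_pow_le. destruct x; auto. Qed.

Lemma mul_succ_lt (a x y : cnf) :
  cnf_lt x y -> cnf_lt (mul_succ a x) (mul_succ a y).
Proof.
  induction 1 as [e r|d e r s H _|e r s _ IH]; cbn [mul_succ].
  - destruct (add_pow_Nil_le a e) as [H| ->]; auto using mul_succ_pos.
  - auto using add_pow_lt.
  - auto.
Qed.

Lemma lt_mul_succ (a x : cnf) : normal x -> cnf_lt x (mul_succ a x).
Proof.
  induction 1 as [|e r He _ Hr IH _]; cbn [mul_succ]; auto.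
  destruct (le_add_pow a e He) as [H|H]; auto.
  rewrite <- H. auto.
Qed.

(** [omega^(omega^b)] is closed under multiplication and exceeds
    [omega^(omega^a)]; in terms of exponents, this is [add_pow_lt_add_pow] at
    the first difference and [add_pow_absorb] before it. *)
Lemma mul_succ_lt_mul_succ (a b x p : cnf) :
  cnf_lt a b -> cnf_lt x (mul_succ b p) -> cnf_lt (mul_succ a x) (mul_succ b p).
Proof.
  intro Hab. revert x. induction p as [|e _ q IH]; intros [|d r] Hx;
    cbn [mul_succ] in *.
  - auto using add_pow_lt_add_pow, add_pow_pos.
  - inversion Hx as [|? ? ? ? H|? ? ? H]; subst; [|inversion H].
    auto using add_pow_lt_add_pow.
  - auto using add_pow_lt_add_pow, add_pow_pos.
  - inversion Hx as [|? ? ? ? H|? ? ? H]; subst.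
    + auto using add_pow_lt_add_pow.
    + rewrite add_pow_absorb; auto.
Qed.

Lemma normal_mul_succ (a x : cnf) :
  normal a -> normal x -> normal (mul_succ a x).
Proof.
  intros Ha Hx. induction Hx as [|e r He _ Hr IH Hh]; cbn [mul_succ].
  - repeat constructor; auto.
  - constructor; auto using normal_add_pow.
    destruct r as [|d s]; cbn [mul_succ head_le].
    + apply add_pow_Nil_le.
    + apply add_pow_le. exact Hh.
Qed.

(** A normal form denotes an ordinal below the tower of height [k] exactly when
    its nesting depth is at most [k]. *)
Fixpoint depth (x : cnf) : nat :=
  match x with Nil => 0 | Cons e r => Nat.max (S (depth e)) (depth r) end.

Lemma depth_add_pow (a x : cnf) :
  depth (add_pow a x) <= Nat.max (S (depth a)) (depth x).
Proof.
  destruct x as [|e r]; cbn [add_pow]; [cbn [depth]; lia|].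
  destruct cnf_lt_dec; cbn [depth]; lia.
Qed.

Lemma depth_mul_succ (a x : cnf) :
  depth (mul_succ a x) <= Nat.max (S (S (depth a))) (depth x).
Proof.
  induction x as [|e _ r IH]; cbn [mul_succ depth].
  - cbn [add_pow depth]. lia.
  - assert (H := depth_add_pow a e). lia.
Qed.

(** * Values of normal forms in the towers *)

(** An element of [omega ^ A] records the multiplicity of each exponent. *)
Fixpoint count {A : Type} (v : cnf -> A) (x : cnf) (c : A) : nat :=
  match x with
  | Nil => 0
  | Cons e r =>
      (if excluded_middle_informative (v e = c) then 1 else 0) + count v r c
  end.

Lemma count_finsupp {A : Type} (v : cnf -> A) (x : cnf) : finsupp (count v x).
Proof.
  induction x as [|e _ r [l Hl]].
  - exists nil. simpl. tauto.
  - exists (v e :: l). intros c Hc. simpl in *.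
    destruct excluded_middle_informative; auto.
Qed.

Fixpoint value (k : nat) : cnf -> omega_tower k :=
  match k with
  | 0 => fun _ => tt
  | S k => fun x => exist _ (count (value k) x) (count_finsupp (value k) x)
  end.

Lemma value_lt (k : nat) (x y : cnf) :
  normal x -> normal y -> depth x <= k -> depth y <= k ->
  cnf_lt x y -> olt (value k x) (value k y).
Proof.
  revert x y. induction k as [|k IH]; intros x y Nx Ny Dx Dy H.
  { destruct H; cbn [depth] in Dy; lia. }
  (* Exponents above the leading one have multiplicity zero. *)
  assert (Habove : forall z e, normal z -> depth z <= S k -> normal e ->
    depth e <= k -> head_le z e ->
    forall c, olt (value k e) c -> count (value k) z c = 0).
  { intros z e Nz. revert e. induction Nz as [|d s Nd _ Ns IHs Hh];
      intros e Dz Ne De Hz c Hc; auto.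
    cbn [depth head_le count] in *.
    assert (Hdc : olt (value k d) c).
    { destruct Hz as [Hz| ->]; auto.
      apply (wo_trans _ (olt_wo (omega_tower k))) with (value k e); auto.
      apply IH; auto. lia. }
    destruct excluded_middle_informative as [E|_].
    - rewrite E in Hdc. destruct (wo_irrefl _ _ Hdc).
    - apply (IHs d); auto; lia. }
  change (omega_exp_lt (omega_tower k) (value (S k) x) (value (S k) y)).
  unfold omega_exp_lt. cbn [value proj1_sig].
  induction H as [e r|d e r s H _|e r s _ IHr];
    inversion Ny as [|? ? Ne Ns Hs]; subst; cbn [depth] in Dy.
  - exists (value k e). split.
    + simpl. destruct excluded_middle_informative; [lia|congruence].
    + intros c Hc. symmetry. apply (Habove (Cons e r) e);
        cbn [depth head_le]; auto; lia.
  - inversion Nx as [|? ? Nd Nr Hr]; subst; cbn [depth] in Dx.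
    assert (Hde : olt (value k d) (value k e)) by (apply IH; auto; lia).
    exists (value k e). split.
    + rewrite (Habove (Cons d r) d); cbn [count depth head_le]; auto; try lia.
      destruct excluded_middle_informative; [lia|congruence].
    + intros c Hc.
      rewrite (Habove (Cons d r) e), (Habove (Cons e s) e);
        cbn [depth head_le]; auto; lia.
  - inversion Nx as [|? ? _ Nr Hr]; subst; cbn [depth] in Dx.
    destruct IHr as [c [Hc Hgt]]; auto; try lia.
    exists c. simpl. split; [lia|]. intros b Hb. rewrite (Hgt b Hb). auto.
Qed.

(** * Coordinates of terms *)

(** The operation at index [0] differs from the others because it has to break
    ties: [omega^c + x] may equal [x], while [omega^(omega^c) * (x + 1)] always
    exceeds [x].  Appending on the right, as in [x + omega^c], would exceed [x]
    too, but it is not strictly increasing in [x]. *)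
Fixpoint coord (t : term) (j : nat) : cnf :=
  match t with
  | Zero => Nil
  | Theta i a =>
      if j <=? i then
        match j with
        | 0 => mul_succ (coord a (S i)) (coord a 0)
        | S _ => add_pow (coord a (S i)) (coord a j)
        end
      else Nil
  end.

Definition lex_lt (u v : nat -> cnf) : Prop :=
  exists d, cnf_lt (u d) (v d) /\ forall j, d < j -> u j = v j.

Lemma lex_lt_irrefl (u : nat -> cnf) : ~ lex_lt u u.
Proof. intros [d [H _]]. exact (cnf_lt_irrefl _ H). Qed.

Lemma lex_lt_trans (u v w : nat -> cnf) :
  lex_lt u v -> lex_lt v w -> lex_lt u w.
Proof.
  intros [d [Hd Ed]] [e [He Ee]].
  destruct (lt_eq_lt_dec d e) as [[H|<-]|H].
  - exists e. rewrite (Ed e H). split; auto.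
    intros j Hj. rewrite Ed by lia. auto.
  - exists d. split; eauto using cnf_lt_trans.
    intros j Hj. rewrite Ed; auto.
  - exists d. rewrite <- (Ee d H). split; auto.
    intros j Hj. rewrite Ed; auto. apply Ee. lia.
Qed.

Lemma lex_lt_of_le (u v : nat -> cnf) (i : nat) :
  (forall j, i < j -> u j = v j) -> (forall j, 0 < j -> cnf_le (u j) (v j)) ->
  cnf_lt (u 0) (v 0) -> lex_lt u v.
Proof.
  intros Heq Hle H0. induction i as [|i IH].
  - exists 0. auto.
  - destruct (Hle (S i)) as [H|H]; [lia| |].
    + exists (S i). auto.
    + apply IH. intros j Hj.
      destruct (Nat.eq_dec j (S i)) as [->|]; auto. apply Heq. lia.
Qed.

Lemma coord_Theta_zero (i : nat) (a : term) :
  coord (Theta i a) 0 = mul_succ (coord a (S i)) (coord a 0).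
Proof. reflexivity. Qed.

Lemma coord_Theta_pos (i j : nat) (a : term) : 0 < j -> j <= i ->
  coord (Theta i a) j = add_pow (coord a (S i)) (coord a j).
Proof.
  intros Hj Hi. destruct j as [|j]; [lia|].
  cbn [coord]. destruct (Nat.leb_spec (S j) i); auto. lia.
Qed.

Lemma coord_above (t : term) (j : nat) :
  (level t < Z.of_nat j)%Z -> coord t j = Nil.
Proof.
  destruct t as [|i a]; simpl; auto. intro H.
  destruct (Nat.leb_spec j i); auto. lia.
Qed.

Lemma coord_normal (t : term) (j : nat) : normal (coord t j).
Proof.
  revert j. induction t as [|i a IH]; intro j; simpl; auto.
  destruct (j <=? i); auto.
  destruct j; auto using normal_mul_succ, normal_add_pow.
Qed.

Lemma coord_le_Theta (i j : nat) (a : term) : j <= i ->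
  cnf_le (coord a j) (coord (Theta i a) j).
Proof.
  intro H. destruct j as [|j].
  - rewrite coord_Theta_zero. left. apply lt_mul_succ, coord_normal.
  - rewrite coord_Theta_pos by lia. apply le_add_pow, coord_normal.
Qed.

Lemma coef_inT (i : nat) (t : term) : inT t -> inT (coef i t).
Proof.
  induction 1 as [|j b Hb IH Hl]; simpl; [constructor|].
  destruct (j <=? i); auto. constructor; auto.
Qed.

Lemma coef_level (i : nat) (t : term) : (level (coef i t) <= Z.of_nat i)%Z.
Proof.
  induction t as [|j b IH]; simpl; [lia|].
  destruct (Nat.leb_spec j i); auto. simpl. lia.
Qed.

Lemma coef_of_level_le (i : nat) (t : term) :
  (level t <= Z.of_nat i)%Z -> coef i t = t.
Proof.
  destruct t as [|j b]; simpl; auto. intro H.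
  destruct (Nat.leb_spec j i); auto. lia.
Qed.

Lemma coord_coef_le (i j : nat) (t : term) : j <= i ->
  cnf_le (coord (coef i t) j) (coord t j).
Proof.
  intro Hj. induction t as [|l b IH]; simpl coef; auto.
  destruct (Nat.leb_spec l i); auto.
  apply cnf_le_trans with (coord b j); auto. apply coord_le_Theta. lia.
Qed.

Lemma coef_lex_lt_Theta (i : nat) (b : term) :
  lex_lt (coord (coef i b)) (coord (Theta i b)).
Proof.
  apply lex_lt_of_le with i.
  - intros j Hj. assert (H := coef_level i b).
    rewrite !coord_above; simpl; auto; lia.
  - intros j _. destruct (Nat.le_gt_cases j i) as [Hj|Hj].
    + apply cnf_le_trans with (coord b j);
        auto using coord_coef_le, coord_le_Theta.
    + assert (H := coef_level i b).
      rewrite !coord_above; simpl; auto; lia.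
  - apply cnf_le_lt_trans with (coord b 0).
    + apply coord_coef_le. lia.
    + rewrite coord_Theta_zero. apply lt_mul_succ, coord_normal.
Qed.

(** The term [t] arises from [coef i t] by applying symbols [theta_l] with
    [l > i].  Each parameter is less than the coefficient that it produces at
    index [l], and a coefficient above index [i] either does not decrease under
    the next symbol or is its parameter.  The coefficients of [t] above [i]
    being below [b], all parameters are.  The bounds [omega^b + p_j] and
    [omega^(omega^b) * (p_0 + 1)] are closed under operations with such
    parameters. *)
Lemma coord_lt_of_coef_lt (i : nat) (b : cnf) (t : term) (p : nat -> cnf) :
  inT t -> (forall j, i < j -> cnf_lt (coord t j) b) ->
  (cnf_lt (coord (coef i t) 0) (mul_succ b (p 0)) ->
   cnf_lt (coord t 0) (mul_succ b (p 0))) /\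
  (forall j, 0 < j -> j <= i ->
   (cnf_lt (coord (coef i t) j) (add_pow b (p j)) ->
    cnf_lt (coord t j) (add_pow b (p j))) /\
   (coord (coef i t) j = add_pow b (p j) -> coord t j = add_pow b (p j))).
Proof.
  intros Ht. induction Ht as [|l s Hs IH Hl]; intro Hb; simpl coef; auto.
  destruct (Nat.leb_spec l i) as [Hli|Hli]; auto.
  assert (Hsl : cnf_lt (coord s (S l)) b).
  { apply cnf_lt_trans with (coord (Theta l s) l); auto.
    rewrite coord_Theta_pos by lia. apply lt_add_pow_exponent. }
  destruct IH as [IH0 IH].
  { intros j Hj. destruct (Nat.le_gt_cases j l) as [Hjl|Hjl].
    - apply cnf_le_lt_trans with (coord (Theta l s) j); auto.
      apply coord_le_Theta. lia.
    - destruct (Nat.eq_dec j (S l)) as [->|]; auto.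
      rewrite coord_above by lia.
      rewrite <- (coord_above (Theta l s) j); [auto|simpl; lia]. }
  split.
  - intro H. rewrite coord_Theta_zero. apply mul_succ_lt_mul_succ; auto.
  - intros j Hj Hji. rewrite coord_Theta_pos by lia.
    destruct (IH j Hj Hji) as [IHlt IHeq]. split; intro H.
    + apply add_pow_lt_add_pow; auto.
    + rewrite IHeq by auto. apply add_pow_absorb. auto.
Qed.

(** This is the clause [lt_arg] of the order, read in the tuples.  Either the
    tuples of [a] and [b] first differ at an index at most [i], and then the
    same operations are applied to both; or they differ at [i + 1], and then
    the comparison of [coef i a] with [theta_i b] carries over to [theta_i a]
    by closure. *)
Lemma Theta_lex_lt (i : nat) (a b : term) :
  inT (Theta i a) -> inT (Theta i b) -> lex_lt (coord a) (coord b) ->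
  lex_lt (coord (coef i a)) (coord (Theta i b)) ->
  lex_lt (coord (Theta i a)) (coord (Theta i b)).
Proof.
  intros Ha Hb [d [Hd Ed]] [e [He Ee]].
  inversion Ha as [|? ? Ta La]; subst. inversion Hb as [|? ? Tb Lb]; subst.
  assert (Htop : forall j, i < j -> coord (Theta i a) j = coord (Theta i b) j).
  { intros j Hj. rewrite !coord_above; simpl; auto; lia. }
  destruct (Nat.le_gt_cases d i) as [Hdi|Hdi].
  - exists d. split.
    + destruct d as [|d].
      * rewrite !coord_Theta_zero, (Ed (S i)) by lia. apply mul_succ_lt; auto.
      * rewrite !coord_Theta_pos, (Ed (S i)) by lia. apply add_pow_lt; auto.
    + intros j Hj. destruct (Nat.le_gt_cases j i) as [Hji|Hji]; auto.
      rewrite !coord_Theta_pos, (Ed (S i)), (Ed j) by lia. auto.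
  - assert (d = S i).
    { apply NNPP. intro Hne. rewrite (coord_above b d) in Hd by lia.
      inversion Hd. }
    subst d.
    assert (Hei : e <= i).
    { apply Nat.nlt_ge. intro Hlt.
      rewrite (coord_above (Theta i b) e) in He by (simpl; lia). inversion He. }
    destruct (coord_lt_of_coef_lt i (coord b (S i)) a (coord b) Ta) as [K0 K].
    { intros j Hj. destruct (Nat.eq_dec j (S i)) as [->|]; auto.
      rewrite coord_above by lia.
      apply cnf_le_lt_trans with (coord a (S i)); auto.
      destruct (coord a (S i)); auto. }
    exists e. split.
    + destruct e as [|e].
      * rewrite coord_Theta_zero in He |- *. rewrite coord_Theta_zero.
        apply mul_succ_lt_mul_succ; auto.
      * rewrite coord_Theta_pos in He by lia. rewrite !coord_Theta_pos by lia.
        apply add_pow_lt_add_pow; auto. apply (K (S e)); auto; lia.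
    + intros j Hj. destruct (Nat.le_gt_cases j i) as [Hji|Hji]; auto.
      specialize (Ee j Hj). rewrite coord_Theta_pos in Ee by lia.
      rewrite !coord_Theta_pos by lia.
      rewrite (proj2 (K j ltac:(lia) Hji) Ee). apply add_pow_absorb. auto.
Qed.

Lemma coord_Theta_level_pos (i : nat) (a : term) :
  cnf_lt Nil (coord (Theta i a) i).
Proof.
  destruct i as [|i].
  - apply mul_succ_pos.
  - rewrite coord_Theta_pos by lia. apply add_pow_pos.
Qed.

(** The induction runs over the derivation of [term_lt a b]; it is written as an
    explicit fixpoint because the clause [lt_coef] has a recursive premise
    inside a disjunction. *)
Lemma coord_lex_lt (a b : term) :
  inT a -> inT b -> term_lt a b -> lex_lt (coord a) (coord b).
Proof.
  revert a b. fix IH 5.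
  intros a b Ha Hb H.
  destruct H as [a H|i j a b H|i a b Hab Hcoef|i a b Hba Hcoef].
  - destruct a as [|i a]; [congruence|]. exists i. split.
    + apply coord_Theta_level_pos.
    + intros j Hj. rewrite !coord_above; simpl; auto; lia.
  - exists j. split.
    + rewrite coord_above by (simpl; lia). apply coord_Theta_level_pos.
    + intros l Hl. rewrite !coord_above; simpl; auto; lia.
  - assert (Ta : inT a) by (inversion Ha; auto).
    assert (Tb : inT b) by (inversion Hb; auto).
    apply Theta_lex_lt; auto using coef_inT.
  - assert (Tb : inT b) by (inversion Hb; auto).
    assert (Hcb := coef_lex_lt_Theta i b).
    destruct Hcoef as [Hcoef|Hcoef].
    + apply lex_lt_trans with (coord (coef i b)); auto using coef_inT.
    + rewrite Hcoef. exact Hcb.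
Qed.

Lemma term_lt_irrefl (t : term) : inT t -> ~ term_lt t t.
Proof.
  intros Ht H. exact (lex_lt_irrefl _ (coord_lex_lt t t Ht Ht H)).
Qed.

Lemma term_lt_asym (s t : term) :
  inT s -> inT t -> term_lt s t -> ~ term_lt t s.
Proof.
  intros Hs Ht H1 H2. apply (lex_lt_irrefl (coord s)).
  apply lex_lt_trans with (coord t); apply coord_lex_lt; auto.
Qed.

(** * Totality of the order on terms *)

Fixpoint size (t : term) : nat :=
  match t with Zero => 0 | Theta _ a => S (size a) end.

Lemma coef_size (i : nat) (t : term) : size (coef i t) <= size t.
Proof.
  induction t as [|j b IH]; simpl; auto. destruct (j <=? i); simpl; lia.
Qed.

Lemma term_lt_total (s t : term) : term_lt s t \/ s = t \/ term_lt t s.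
Proof.
  remember (size s + size t) as n eqn:E. revert s t E.
  induction n as [n IH] using (well_founded_induction lt_wf). intros s t ->.
  destruct s as [|i a], t as [|j b]; auto;
    try (left; constructor; congruence);
    try (right; right; constructor; congruence).
  destruct (lt_eq_lt_dec i j) as [[H|<-]|H]; auto using lt_level.
  assert (Ha := coef_size i a). assert (Hb := coef_size i b). simpl in *.
  destruct (IH (size a + size b) ltac:(lia) a b eq_refl) as [H|[<-|H]]; auto.
  - destruct (IH (size (coef i a) + size (Theta i b)) ltac:(simpl; lia)
      (coef i a) (Theta i b) eq_refl) as [K|[K|K]]; auto using lt_arg, lt_coef.
  - destruct (IH (size (coef i b) + size (Theta i a)) ltac:(simpl; lia)
      (coef i b) (Theta i a) eq_refl) as [K|[K|K]]; auto using lt_arg, lt_coef.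
Qed.

(** * Terms below the tower *)

Fixpoint occurs (m : nat) (t : term) : Prop :=
  match t with Zero => False | Theta i a => i = m \/ occurs m a end.

(** The tower started at [theta_j].  Counting the [d] symbols in front of
    [Omega (j + d)] makes the recursion structural. *)
Definition stage (j d : nat) : term := fold_right Theta (Omega (j + d)) (seq j d).

Definition term_le (s t : term) : Prop := term_lt s t \/ s = t.

Lemma stage_S (j d : nat) : stage j (S d) = Theta j (stage (S j) d).
Proof. unfold stage. simpl. rewrite Nat.add_succ_r. reflexivity. Qed.

Lemma coef_stage (i j d : nat) : i < j -> coef i (stage j d) = Zero.
Proof.
  revert j. induction d as [|d IH]; intros j H.
  - unfold stage. simpl. destruct (Nat.leb_spec (j + 0) i); auto. lia.
  - rewrite stage_S. simpl. destruct (Nat.leb_spec j i); [lia|]. apply IH. lia.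
Qed.

(** Adding symbols on the outside of [theta_m] preserves such a lower bound:
    since [coef i (stage (S i) d)] is zero, [stage (S i) d <= a] implies
    [theta_i (stage (S i) d) <= theta_i a].  The coefficient
    [coef j t], and not [t] itself, has to be bounded: a symbol such as
    [theta_1] in front of a term of level [0] may give a term below [stage 1 d]
    although [theta_m] occurs in it. *)
Lemma stage_le_coef (m : nat) (t : term) : inT t -> occurs m t ->
  exists j d, j + d = m /\ (Z.of_nat j <= level t)%Z /\
              term_le (stage j d) (coef j t).
Proof.
  induction 1 as [|i a Ha IH Hl]; [intros []|].
  destruct (Nat.eq_dec i m) as [->|Him].
  - intros _. exists m, 0. split; [lia|]. split; [simpl; lia|].
    simpl coef. rewrite Nat.leb_refl. unfold stage. simpl. rewrite Nat.add_0_r.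
    destruct a as [|k b]; [right; reflexivity|]. left. unfold Omega.
    apply lt_arg; simpl; constructor; congruence.
  - intros [|Ho]; [congruence|].
    destruct (IH Ho) as [j [d [Hm [Hj Hle]]]].
    assert (Hst : forall e, S i + e = m ->
              term_le (stage (S i) e) a ->
              term_le (stage i (S e)) (Theta i a)).
    { intros e He Hs. rewrite stage_S. destruct Hs as [Hs|Hs].
      - left. apply lt_arg; auto. rewrite coef_stage by lia.
        constructor. congruence.
      - right. congruence. }
    (* For [j < i] the coefficient is unchanged by [theta_i]; for [j = i] it is
       a coefficient that [theta_i a] exceeds; for [j = i + 1] it is [a]. *)
    destruct (lt_eq_lt_dec j i) as [[Hji|Hji]|Hji].
    + exists j, d. simpl. destruct (Nat.leb_spec i j); [lia|].
      repeat split; auto. lia.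
    + subst j. exists i, d. simpl. rewrite Nat.leb_refl.
      repeat split; auto; [lia|]. destruct d as [|d]; [lia|].
      destruct (term_lt_total (stage (S i) d) a) as [H|[H|H]].
      * apply Hst; [lia|]. left. auto.
      * apply Hst; [lia|]. right. auto.
      * left. rewrite stage_S in *. apply lt_coef; auto.
    + assert (j = S i) by lia. subst j. exists i, (S d).
      simpl. rewrite Nat.leb_refl. repeat split; [lia|lia|].
      apply Hst; auto. rewrite coef_of_level_le in Hle by lia. auto.
Qed.

Lemma theta_tower_stage (n : nat) : theta_tower_term n = stage 0 (n + 1).
Proof. reflexivity. Qed.

Lemma level_of_lt_theta_tower (n : nat) (g : term) :
  inT g -> term_lt g (theta_tower_term n) -> (level g <= 0)%Z.
Proof.
  intros Hg H. rewrite theta_tower_stage, Nat.add_1_r, stage_S in H.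
  destruct g as [|i a]; simpl; [lia|].
  inversion H; subst; lia.
Qed.

Lemma not_occurs_of_lt_theta_tower (n : nat) (g : term) :
  inT g -> term_lt g (theta_tower_term n) -> ~ occurs (n + 1) g.
Proof.
  intros Hg H Ho. assert (Hl := level_of_lt_theta_tower n g Hg H).
  destruct (stage_le_coef _ _ Hg Ho) as [j [d [Hd [Hj Hle]]]].
  assert (j = 0) by lia. subst j. simpl in Hd. subst d.
  rewrite coef_of_level_le in Hle by auto.
  rewrite <- theta_tower_stage in Hle.
  assert (Ht := theta_tower_inT n).
  destruct Hle as [Hle|Hle].
  - exact (term_lt_asym _ _ Ht Hg Hle H).
  - rewrite Hle in H. exact (term_lt_irrefl _ Hg H).
Qed.

(** At index [j] at most [i], the exponent [a_(i+1)] has depth at most [n - i],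
    so one exponential stays within [n + 1 - j] when [j >= 1], and two stay
    within [n + 2] at [j = 0]. *)
Lemma coord_depth (n : nat) (t : term) :
  inT t -> (level t <= Z.of_nat n)%Z -> ~ occurs (n + 1) t ->
  depth (coord t 0) <= n + 2 /\
  forall j, 0 < j -> depth (coord t j) <= n + 1 - j.
Proof.
  induction 1 as [|i a Ha IH Hl]; intros Hn Ho.
  { simpl. split; intros; lia. }
  simpl in Hn, Ho.
  assert (Hla : (level a <= Z.of_nat n)%Z).
  { destruct a as [|k b]; simpl in *; [lia|]. lia. }
  destruct IH as [H0 IH]; [auto|tauto|].
  assert (Hs := IH (S i) ltac:(lia)). split.
  - rewrite coord_Theta_zero.
    assert (K := depth_mul_succ (coord a (S i)) (coord a 0)). lia.
  - intros j Hj. destruct (Nat.le_gt_cases j i) as [Hji|Hji].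
    + rewrite coord_Theta_pos by lia.
      assert (K := depth_add_pow (coord a (S i)) (coord a j)).
      specialize (IH j Hj). lia.
    + rewrite coord_above by (simpl; lia). simpl. lia.
Qed.

Definition ordinal_of (n : nat) (g : predecessors (theta_tower n)) :
  omega_tower (n + 2) :=
  value (n + 2) (coord (proj1_sig (proj1_sig g)) 0).

Lemma ordinal_of_lt (n : nat) (g h : predecessors (theta_tower n)) :
  predecessors_lt (theta_tower n) g h ->
  olt (ordinal_of n g) (ordinal_of n h).
Proof.
  destruct g as [[g Hg] Lg], h as [[h Hh] Lh].
  unfold predecessors_lt, T_lt in *. simpl in *. intro Hlt.
  assert (Bg := level_of_lt_theta_tower n g Hg Lg).
  assert (Bh := level_of_lt_theta_tower n h Hh Lh).
  apply value_lt; simpl; auto using coord_normal.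
  - apply coord_depth; eauto using not_occurs_of_lt_theta_tower. lia.
  - apply coord_depth; eauto using not_occurs_of_lt_theta_tower. lia.
  - destruct (coord_lex_lt g h Hg Hh Hlt) as [d [Hd _]].
    destruct d as [|d]; auto.
    rewrite (coord_above h) in Hd by lia. inversion Hd.
Qed.

(** Well-foundedness is inherited from the tower.  Transitivity follows from
    totality, since the order is mapped increasingly into a strict order. *)
Lemma predecessors_well_order (n : nat) :
  is_well_order (predecessors_lt (theta_tower n)).
Proof.
  assert (Htot : forall g h, predecessors_lt (theta_tower n) g h \/ g = h \/
                             predecessors_lt (theta_tower n) h g).
  { intros [[g Hg] Lg] [[h Hh] Lh]. unfold predecessors_lt, T_lt. simpl.
    destruct (term_lt_total g h) as [H|[H|H]]; auto. right; left. subst h.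
    assert (Hg = Hh) by apply proof_irrelevance. subst Hh.
    f_equal. apply proof_irrelevance. }
  assert (Htr := wo_trans _ (olt_wo (omega_tower (n + 2)))).
  split; auto.
  - apply wf_incl with (fun g h => olt (ordinal_of n g) (ordinal_of n h)).
    + intros g h. apply ordinal_of_lt.
    + apply wf_inverse_image. apply (wo_wf _ (olt_wo _)).
  - intros x y z Hxy Hyz.
    assert (H := Htr _ _ _ (ordinal_of_lt _ _ _ Hxy) (ordinal_of_lt _ _ _ Hyz)).
    destruct (Htot x z) as [K|[K|K]]; auto.
    + subst z. destruct (wo_irrefl _ _ H).
    + apply ordinal_of_lt in K. destruct (wo_irrefl _ _ (Htr _ _ _ H K)).
Qed.

Theorem corollary5 : forall n : nat, 1 <= n ->
  exists W : is_well_order (predecessors_lt (theta_tower n)),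
    ord_le (order_type (theta_tower n) W) (omega_tower (n + 2)).
Proof.
  intros n _. exists (predecessors_well_order n).
  apply ord_le_of_increasing with (f := ordinal_of n : order_type _ _ -> _).
  exact (ordinal_of_lt n).
Qed.
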